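(* Let $k\in\mathbb{Z}$ and $n,d\in\mathbb{Z}^+$. For $\alpha\in\mathbb{Z}$ let \[f(\alpha,t)=\frac{(k-\alpha)t+\alpha}{(1-t)(2t^2+t+1)}=\sum_{i=0}^\infty f_i(\alpha)t^i\] be the expansion as a formal power series in $t$. Then $\chi_{n,k}(T_{2,d})$ exists if and only if there exists $\alpha\in\mathbb{Z}$ such that $f_{d+1}(\alpha)\equiv0\pmod n$.
   Context: $T_{2,d}$ is the rooted perfect binary tree of height $d$: the root is at level $0$, every vertex at level $i<d$ has exactly two children (at level $i+1$), and the vertices at level $d$ are leaves. For a graph $G=(V,E)$, a labeling $\ell:V\to\mathbb{Z}$ is proper if adjacent vertices get distinct labels, and it is a closed coloring with remainder $k\bmod n$ if $\sum_{w\in N[v]}\ell(w)\equiv k\pmod n$ for every $v$, where $N[v]$ is the closed neighborhood of $v$. $\chi_{n,k}(G)$ exists iff a proper closed coloring with remainder $k\bmod n$ exists. *)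

(* Defs.v *)
From HB Require Import structures.
From mathcomp Require Import all_boot all_order all_algebra.

Set Implicit Arguments.
Unset Strict Implicit.
Unset Printing Implicit Defensive.

Import Order.TTheory GRing.Theory Num.Theory.

Local Open Scope ring_scope.

Record sgraph := SGraph {
  vertex :> finType;
  adj : rel vertex;
  adj_sym : symmetric adj;
  adj_irrefl : irreflexive adj
}.

Section Colorings.
Variable G : sgraph.

Definition closed_nbhd (v : G) : {set G} := [set w | (w == v) || adj v w].

Definition proper (l : G -> int) : Prop :=
  forall u v : G, adj u v -> l u <> l v.

Definition closed_coloring (n : nat) (k : int) (l : G -> int) : Prop :=
  forall v : G, (\sum_(w in closed_nbhd v) l w = k %[mod n%:Z])%Z.

End Colorings.

Definition chi_exists (n : nat) (k : int) (G : sgraph) : Prop :=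
  exists l : G -> int, proper l /\ closed_coloring n k l.

(* A vertex of the perfect binary tree of height d is encoded by the path that
   leads to it from the root, i.e. a binary word of length at most d: the root
   is the empty word, the level of a vertex is the length of the word, and the
   children of u are the words obtained by appending one bit to u. *)
Section PerfectBinaryTree.
Variable d : nat.

Definition child (u v : d.-bseq bool) : bool :=
  [exists b : bool, (v : seq bool) == rcons u b].

Definition tree_adj : rel (d.-bseq bool) :=
  fun u v => child u v || child v u.

Lemma tree_adj_sym : symmetric tree_adj.
Proof. by move=> u v; rewrite /tree_adj orbC. Qed.

Lemma tree_adj_irrefl : irreflexive tree_adj.
Proof.
move=> u; rewrite /tree_adj orbb; apply/existsP => -[b /eqP /(congr1 size)].
by rewrite size_rcons => /n_Sn.
Qed.

Definition T2 : sgraph := SGraph tree_adj_sym tree_adj_irrefl.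

End PerfectBinaryTree.

(* A formal power series is the function giving its coefficients. *)
Section FormalPowerSeries.
Variable R : comUnitRingType.

Definition fps := nat -> R.

Definition fps_of_poly (p : {poly R}) : fps := fun i => p`_i.

Definition fps_mul (a b : fps) : fps :=
  fun m => \sum_(i < m.+1) a i * b (m - i)%N.

(* The first m coefficients g_0, ..., g_(m-1) of the inverse of a, obtained by
   solving a_0 g_0 = 1 and \sum_(i <= m) a_(m-i) g_i = 0 for m > 0. *)
Fixpoint fps_inv_prefix (a : fps) (m : nat) : seq R :=
  if m is m'.+1 then
    let s := fps_inv_prefix a m' in
    rcons s ((a 0%N)^-1 *
      ((m' == 0%N)%:R - \sum_(i < m') a (m' - i)%N * s`_i))
  else [::].

(* Meaningful when a_0 is a unit. *)
Definition fps_inv (a : fps) : fps := fun m => (fps_inv_prefix a m.+1)`_m.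

Definition fps_div (a b : fps) : fps := fps_mul a (fps_inv b).

Lemma size_fps_inv_prefix a m : size (fps_inv_prefix a m) = m.
Proof. by elim: m => //= m IHm; rewrite size_rcons IHm. Qed.

Lemma nth_fps_inv_prefix a m i :
  (i < m)%N -> (fps_inv_prefix a m)`_i = fps_inv a i.
Proof.
elim: m => // m IHm; rewrite ltnS leq_eqVlt => /orP[/eqP -> //|ltim] /=.
by rewrite nth_rcons size_fps_inv_prefix ltim IHm.
Qed.

Lemma fps_mulV a : a 0%N \is a GRing.unit ->
  fps_mul a (fps_inv a) =1 fps_of_poly 1.
Proof.
move=> ua m; rewrite /fps_of_poly coef1 /fps_mul (reindex_inj rev_ord_inj) /=.
rewrite big_ord_recr /= subSS subnn subn0 {2}/fps_inv /=.
rewrite nth_rcons size_fps_inv_prefix ltnn eqxx mulVKr //.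
rewrite [X in X + _ = _](_ : _ =
  \sum_(i < m) a (m - i)%N * (fps_inv_prefix a m)`_i).
  by rewrite addrC subrK.
apply: eq_bigr => i _; rewrite nth_fps_inv_prefix // subSS subKn //.
exact: ltnW.
Qed.

End FormalPowerSeries.

Definition f_num (k alpha : int) : {poly int} := (k - alpha) *: 'X + alpha%:P.

Definition f_den : {poly int} := (1 - 'X) * (2%:R *: 'X^2 + 'X + 1).

Definition f (k alpha : int) : fps int :=
  fps_div (fps_of_poly (f_num k alpha)) (fps_of_poly f_den).

Lemma f_den0 : fps_of_poly f_den 0%N = 1.
Proof.
rewrite /fps_of_poly /f_den coef0M coefB !coefD coefZ coefXn coefX !coef1.
by [].
Qed.

(* Main.v *)
Require Import Defs.
From mathcomp Require Import all_boot all_order all_algebra.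
From mathcomp Require Import zify ring.

(* Write f_i(alpha) = c_i alpha + e_i k; it satisfies f_0 + f_1 = k and
   f_(i+2) + f_(i+1) + 2 f_i = k.  These are exactly the conditions on a
   coloring that takes the value f_i at height i (distance to the leaves), the
   condition at the root being f_(d+1) = 0 mod n; adding n at every other level
   makes it proper.
   Conversely a closed coloring need not be constant on levels mod n, but if
   S_i is the sum of its labels at height i, then A_i = 2^i S_i satisfies the
   same recurrence with k replaced by 2^d k, so
   c_(d+1) A_0 + 2^d e_(d+1) k = 0 mod n.  Since c_(d+1) is odd,
   gcd(c_(d+1), n) divides e_(d+1) k, and Bezout's identity gives alpha. *)

Set Implicit Arguments.
Unset Strict Implicit.
Unset Printing Implicit Defensive.

Import Order.TTheory GRing.Theory Num.Theory.

Local Open Scope ring_scope.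

(** * Coefficients of [f]: recurrence, parity and congruences *)

Lemma f_denE : f_den = 1 + 'X^2 - 2%:R *: 'X^3.
Proof. by rewrite /f_den -!mul_polyC polyC_natr; ring. Qed.

Definition den_inv : fps int := fps_inv (fps_of_poly f_den).

Lemma coef_f_den i :
  fps_of_poly f_den i = (i == 0)%:R + (i == 2)%:R - 2%:R * (i == 3)%:R.
Proof. by rewrite /fps_of_poly f_denE coefB coefD coefZ !coefXn coef1. Qed.

Lemma fps_mul_f_den m :
  fps_mul (fps_of_poly f_den) den_inv m = (m == 0%N)%:R.
Proof. by rewrite fps_mulV ?f_den0 // /fps_of_poly coef1. Qed.

Lemma den_inv0 : den_inv 0%N = 1.
Proof.
have := fps_mul_f_den 0; rewrite /fps_mul big_ord_recl big_ord0 coef_f_den /=.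
by rewrite subnn; lia.
Qed.

Lemma den_inv1 : den_inv 1%N = 0.
Proof.
have := fps_mul_f_den 1; rewrite /fps_mul !big_ord_recl big_ord0 !coef_f_den /=.
by rewrite subn0; lia.
Qed.

Lemma den_inv2 : den_inv 2%N = -1.
Proof.
have := fps_mul_f_den 2; rewrite /fps_mul !big_ord_recl big_ord0 !coef_f_den /=.
rewrite subn0 subnn den_inv0; lia.
Qed.

Lemma den_inv_rec m : den_inv m.+3 = 2%:R * den_inv m - den_inv m.+1.
Proof.
have := fps_mul_f_den m.+3.
rewrite /fps_mul !big_ord_recl big1 => [|i _]; rewrite !coef_f_den /=.
  rewrite /bump /= !addn0 !add1n subn0 !subSS !subn0; lia.
by rewrite /bump /= mulr0 subr0 mul0r.
Qed.

(** Identifies the coefficients of the overview: c_(m+1) is [den_inv m.+1 - den_inv m] and e_(m+1)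
    is [den_inv m]. *)
Lemma fS k alpha m :
  f k alpha m.+1 = alpha * (den_inv m.+1 - den_inv m) + k * den_inv m.
Proof.
rewrite /f /fps_div /fps_mul !big_ord_recl big1 => [|i _];
  rewrite /fps_of_poly /f_num !coefD !coefZ !coefX !coefC /=.
  by rewrite /bump /= subSS !subn0 -/den_inv; ring.
by rewrite mulr0 addr0 mul0r.
Qed.

Lemma f0 k alpha : f k alpha 0%N = alpha.
Proof.
rewrite /f /fps_div /fps_mul big_ord_recl big_ord0 /fps_of_poly /f_num.
by rewrite coefD coefZ coefX coefC /= -/den_inv subnn den_inv0; ring.
Qed.

Lemma f01 k alpha : f k alpha 0%N + f k alpha 1%N = k.
Proof. by rewrite f0 fS den_inv0 den_inv1; ring. Qed.

(** Multiplying f by 2t^2+t+1 leaves ((k-alpha)t+alpha)/(1-t), whose coefficients from degree 1 on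
    all equal k. *)
Lemma f_rec k alpha m :
  f k alpha m.+2 + f k alpha m.+1 + 2%:R * f k alpha m = k.
Proof.
elim: m => [|m IHm]; first by rewrite f0 !fS den_inv0 den_inv1 den_inv2; ring.
case: m IHm => [|m] IHm.
  by rewrite !fS den_inv_rec den_inv0 den_inv1 den_inv2; ring.
move: IHm; rewrite !fS !den_inv_rec; lia.
Qed.

(** By [den_inv_rec] the parity of consecutive differences propagates, and the first two differences
    are -1. *)
Lemma coprimez_den_inv_diff m : coprimez (den_inv m.+1 - den_inv m) 2.
Proof.
suff [q ->]: exists q, den_inv m.+1 - den_inv m = 1 + 2 * q.
  by apply/coprimezP; exists (1, - q) => /=; ring.
elim: m => [|m [q IHm]]; first by exists (-1); rewrite den_inv1 den_inv0.
case: m IHm => [|m] IHm; first by exists (-1); rewrite den_inv1 den_inv2.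
by exists (den_inv m - den_inv m.+1 - q - 1); rewrite den_inv_rec; lia.
Qed.

(** Each relation has coefficient 1 at its highest index, so modulo n it determines the next term
    from the previous ones. *)
Lemma f_approx (n K : int) (d : nat) (A : nat -> int) :
  (n %| A 0%N + A 1%N - K)%Z ->
  (forall i, (i < d)%N -> (n %| A i.+2 + A i.+1 + 2 * A i - K)%Z) ->
  forall i, (i <= d.+1)%N -> (n %| A i - f K (A 0%N) i)%Z.
Proof.
move=> base step.
suff H i : (i <= d)%N -> (n %| A i - f K (A 0%N) i)%Z /\
                         (n %| A i.+1 - f K (A 0%N) i.+1)%Z.
  case=> [|i] lei; first by have [] := H 0%N.
  by have [] := H i.
elim: i => [_|i IHi lti].
  split; first by rewrite f0 subrr dvdz0.
  have := f01 K (A 0%N); rewrite f0 => f01E.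
  by rewrite (_ : _ - _ = A 0%N + A 1%N - K) //; lia.
have [Ai Ai1] := IHi (ltnW lti); split=> //.
have frec := f_rec K (A 0%N) i.
rewrite (_ : _ - _ = (A i.+2 + A i.+1 + 2 * A i - K)
  - (A i.+1 - f K (A 0%N) i.+1) - 2 * (A i - f K (A 0%N) i)); last by lia.
by apply/rpredB/dvdz_mull => //; apply/rpredB => //; apply: step.
Qed.

Lemma f_solvable (n : nat) (k a : int) (d e : nat) :
  (n%:Z %| f (2 ^+ e * k) a d.+1)%Z -> exists alpha, (n%:Z %| f k alpha d.+1)%Z.
Proof.
rewrite fS; set c := den_inv _ - _; set h := den_inv _ => n_dvd.
(* The gcd divides both a c and n, hence 2^e k h; as a divisor of the odd number c it is coprime to
   2^e, which cancels. *)
have g_dvd : (gcdz c n %| k * h)%Z.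
  rewrite -(@Gauss_dvdzr _ (2 ^+ e)).
    rewrite (_ : _ * _ = (a * c + 2 ^+ e * k * h) - a * c); last by ring.
    apply: rpredB; first exact: dvdz_trans (dvdz_gcdr _ _) n_dvd.
    exact/dvdz_mull/dvdz_gcdl.
  apply/coprimezXr/(coprimez_dvdl _ (coprimez_den_inv_diff d)).
  exact: dvdz_gcdl.
have [q khE] := dvdzP g_dvd.
have [u [v uvE]] := Bezoutz c n.
(* With k h = q g and g = u c + v n for the gcd g, this choice turns alpha c + k h into q v n. *)
exists (- (q * u)); rewrite fS -/c -/h khE -uvE.
rewrite (_ : _ + _ = q * v * n%:Z); last by ring.
exact: dvdz_mull.
Qed.

(** * Level sums and closed neighborhoods in the tree *)

(** Plain words rather than bounded ones, so that a level does not depend on [d] and arises by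
    recursion. *)
Fixpoint words (m : nat) : seq (seq bool) :=
  if m is m'.+1 then [seq rcons u b | u <- words m', b <- [:: false; true]]
  else [:: [::]].

Lemma size_words m u : u \in words m -> size u = m.
Proof.
elim: m u => [|m IHm] u; first by rewrite inE => /eqP ->.
by case/allpairsPdep=> v [b [/IHm sz_v _ ->]]; rewrite size_rcons sz_v.
Qed.

Lemma sum_wordsS (V : zmodType) m (F : seq bool -> V) :
  \sum_(u <- words m.+1) F u =
  \sum_(u <- words m) (F (rcons u false) + F (rcons u true)).
Proof.
rewrite big_allpairs_dep; apply: eq_bigr => u _.
by rewrite !big_cons big_nil /= addr0.
Qed.

Lemma sum_words1 m : \sum_(u <- words m) (1 : int) = 2 ^+ m.
Proof.
elim: m => [|m IHm]; first by rewrite big_seq1.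
by rewrite sum_wordsS big_split /= IHm exprS; ring.
Qed.

Definition parent (u : seq bool) := take (size u).-1 u.

Lemma parent_rcons u b : parent (rcons u b) = u.
Proof. by rewrite /parent size_rcons -cats1 take_size_cat. Qed.

Section Neighborhoods.
Variables (d : nat) (V : zmodType) (F : seq bool -> V).

Definition nbhd_sum (u : seq bool) : V :=
  F u + (if (size u < d)%N then F (rcons u false) + F (rcons u true) else 0)
      + (if (0 < size u)%N then F (parent u) else 0).

Lemma sum_children (v : T2 d) :
  \sum_(w : T2 d | child v w) F (w : d.-bseq bool) =
  if (size (v : d.-bseq bool) < d)%N
  then F (rcons v false) + F (rcons v true) else 0.
Proof.
case: ifP => [ltvd|gevd]; last first.
  apply: big1 => w /existsP[b /eqP wE].
  by have := size_bseq w; rewrite wE size_rcons gevd.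
have Kb b : (size (rcons v b) <= d)%N by rewrite size_rcons.
pose c b : T2 d := Bseq (Kb b).
rewrite (bigD1 (c false)) /=; last by apply/existsP; exists false.
rewrite (big_pred1 (c true)) // => w /=.
rewrite -!val_eqE /=; apply/andP/eqP => [[/existsP[b /eqP wE]]|wE].
  by rewrite wE; case: b {wE}; rewrite ?eqxx.
split; first by apply/existsP; exists true; rewrite wE.
by rewrite wE eqseq_rcons andbF.
Qed.

Lemma sum_parents (v : T2 d) :
  \sum_(w : T2 d | child w v) F (w : d.-bseq bool) =
  if (0 < size (v : d.-bseq bool))%N then F (parent v) else 0.
Proof.
have := size_bseq v; move vE: (bseqval v) => s; case/lastP: s vE => [|u b] vE sz_v.
  by apply: big1 => w /existsP[b]; rewrite vE eq_sym -size_eq0 size_rcons.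
rewrite size_rcons in sz_v; rewrite size_rcons /= parent_rcons.
pose p : T2 d := Bseq (ltnW sz_v).
rewrite (big_pred1 p) // => w /=.
rewrite /child -val_eqE vE.
apply/existsP/eqP => /= [[b' /eqP/rcons_inj[-> _ //]]|->].
by exists b.
Qed.

Lemma sum_closed_nbhd (v : T2 d) :
  \sum_(w in closed_nbhd v) F (w : d.-bseq bool) = nbhd_sum (v : d.-bseq bool).
Proof.
(* Comparing lengths shows that a vertex, its children and its parent are distinct, so no label is
   counted twice. *)
have child_size (x y : d.-bseq bool) : child x y -> size y = (size x).+1.
  by case/existsP=> b /eqP ->; rewrite size_rcons.
have childvv : child v v = false by case cvv: (child v v) => //; have := child_size _ _ cvv; lia.
have childC w : child v w -> child w v = false.
  move=> /child_size cvw; case cwv: (child w v) => //.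
  by have := child_size _ _ cwv; lia.
rewrite (bigD1 v) ?inE ?eqxx //= /nbhd_sum -addrA; congr (_ + _).
rewrite -sum_children -sum_parents (bigID (fun w => child v w)) /=.
congr (_ + _); apply: eq_bigl => w; rewrite inE /= /tree_adj;
  case: eqVneq => [->|_]; rewrite ?childvv //=;
  by case cvw: (child v w); rewrite /= ?andbT ?andbF // childC.
Qed.

End Neighborhoods.

(** Double counting: each vertex of level [j.-1] is the parent of two vertices of level [j], hence
    the factor 2. *)
Lemma sum_nbhd_sum (d j : nat) (V : zmodType) (F : seq bool -> V) :
  let S i := \sum_(u <- words i) F u in
  \sum_(u <- words j) nbhd_sum d F u =
  S j + (if (j < d)%N then S j.+1 else 0)
      + (if (0 < j)%N then S j.-1 *+ 2 else 0).
Proof.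
move=> S; rewrite !big_split /=; congr (_ + _ + _).
  rewrite /S sum_wordsS; case: ifP => ltjd.
    by apply: eq_big_seq => u /size_words ->; rewrite ltjd.
  by apply: big1_seq => u /andP[_ /size_words ->]; rewrite ltjd.
case: j => [|j]; first by rewrite big_seq1.
rewrite sum_wordsS mulr2n -big_split; apply: eq_bigr => u _.
by rewrite !size_rcons !parent_rcons.
Qed.

(** * From a closed coloring to alpha *)

Lemma f_dvd_of_chi_exists (k : int) (n d : nat) : (0 < d)%N ->
  chi_exists n k (T2 d) -> exists alpha, (n%:Z %| f k alpha d.+1)%Z.
Proof.
move=> d_gt0 [l [_ l_closed]].
(* Words longer than [d] get a default label, which the level guards keep out of the sums. *)
pose F (u : seq bool) := l (insub_bseq d u).
have FE (v : T2 d) : l v = F (v : d.-bseq bool).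
  by rewrite /F /insub_bseq valKd.
pose S i := \sum_(u <- words i) F u.
have S_eq j : (j <= d)%N ->
  (n%:Z %| S j + (if (j < d)%N then S j.+1 else 0)
         + (if (0 < j)%N then S j.-1 *+ 2 else 0) - 2 ^+ j * k)%Z.
  move=> lejd; rewrite -sum_nbhd_sum -sum_words1 mulr_suml -sumrB big_seq.
  apply: rpred_sum => u /size_words szu; rewrite mul1r.
  have leud : (size u <= d)%N by rewrite szu.
  rewrite -[u]/(Bseq leud : seq bool) -sum_closed_nbhd.
  rewrite -(eq_bigr _ (fun w _ => FE w)).
  by rewrite -eqz_mod_dvd; apply/eqP/l_closed.
(* [S] is indexed by level, [A] by height. The weight 2^i absorbs the doubled parent term; the value
   0 at d+1 stands for the missing parent of the root, which thus obeys the generic relation. *)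
pose A i := if (i <= d)%N then 2 ^+ i * S (d - i)%N else 0.
suff: (n%:Z %| A d.+1 - f (2 ^+ d * k) (A 0%N) d.+1)%Z.
  by rewrite {1}/A ltnn sub0r rpredN; apply: f_solvable.
apply: (f_approx (d := d)) => // [|i ltid].
  have := S_eq d (leqnn d); rewrite /A ltnn d_gt0 leq0n subn0 subn1.
  by rewrite (_ : _ - _ = 2 ^+ 0 * S d + 2 ^+ 1 * S d.-1 - 2 ^+ d * k) //; ring.
(* The relation at level d-i-1, multiplied by 2^(i+1), is the recurrence for [A] at i. *)
have := dvdz_mull (2 ^+ i.+1) (S_eq (d - i.+1)%N (leq_subr _ _)).
rewrite /A ltid (ltnW ltid) ltn_subrL /= d_gt0 -subSn // subSS subn_gt0.
have -> : (2 ^+ d : int) = 2 ^+ i.+1 * 2 ^+ (d - i.+1) by rewrite -exprD subnKC.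
rewrite -subnS; case: ifP => _; rewrite ?exprS;
  set lhs := (X in (_ %| X)%Z -> _); set rhs := (X in _ -> (_ %| X)%Z);
  by have -> : lhs = rhs by rewrite /lhs /rhs; ring.
Qed.

(** * From alpha to a proper closed coloring *)

Lemma chi_exists_of_f_dvd (k alpha : int) (n d : nat) : (0 < n)%N -> (0 < d)%N ->
  (n%:Z %| f k alpha d.+1)%Z -> chi_exists n k (T2 d).
Proof.
move=> n_gt0 d_gt0 n_dvd; pose g := f k alpha.
(* Reduces the label to its residue, then adds n on odd levels: adjacent levels get labels in [0, n)
   and [n, 2n). *)
pose q m : int := (odd m)%:Z - (g (d - m)%N %/ n)%Z.
pose h m : int := g (d - m)%N + q m * n.
have hE m : h m = (g (d - m)%N %% n)%Z + (odd m)%:Z * n.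
  by rewrite /h /q {1}(divz_eq (g (d - m)%N) n); ring.
have h_neq m : h m <> h m.+1.
  have n_gt0z : 0 < n%:Z by [].
  have nz_n : n%:Z != 0 by rewrite gt_eqF.
  have := (modz_ge0 (g (d - m)%N) nz_n, ltz_pmod (g (d - m)%N) n_gt0z).
  have := (modz_ge0 (g (d - m.+1)%N) nz_n, ltz_pmod (g (d - m.+1)%N) n_gt0z).
  by rewrite !hE /=; case: (odd m) => /=; lia.
exists (fun v : T2 d => h (size (v : d.-bseq bool))); split.
  move=> u v /= /orP[] /existsP[b /eqP ->]; rewrite size_rcons.
    exact: h_neq.
  by move/esym; apply: h_neq.
move=> v; apply/eqP; rewrite eqz_mod_dvd.
rewrite (@sum_closed_nbhd _ _ (fun u => h (size u))) /nbhd_sum !size_rcons.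
have := size_bseq v; set m := size _ => lemd.
have -> : size (parent v) = m.-1.
  by rewrite size_take -/m; case: (m) => //= m'; rewrite ltnSn.
move: m lemd => m; rewrite leq_eqVlt => /orP[/eqP->|ltmd].
  rewrite ltnn d_gt0 /h subnn -subn1 subKn //.
  apply/dvdzP; exists (q d + q (d - 1)%N).
  by have := f01 k alpha; rewrite -/g; lia.
(* [j] is the height of the children, so [f_rec] at [j] links children, vertex and parent. *)
have [j dE] : exists j, d = (m + j).+1.
  by exists (d - m.+1)%N; rewrite -addSn subnKC.
have frec := f_rec k alpha j; rewrite ltmd.
case: m => [|m] in ltmd dE *.
  (* At the root no parent carries the term f_(d+1) of the recurrence; the hypothesis makes it
     vanish mod n. *)
  have -> : h 0%N + (h 1%N + h 1%N) + 0 - k =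
      (q 0%N + 2 * q 1%N) * n - f k alpha d.+1.
    rewrite /h (_ : d - 0 = j.+1)%N 1?(_ : d - 1 = j)%N 1?(_ : d.+1 = j.+2)%N;
      [|lia..].
    by move: frec; rewrite -/g; lia.
  by apply: rpredB => //; apply: dvdz_mull.
apply/dvdzP; exists (q m.+1 + 2 * q m.+2 + q m).
rewrite /h /= (_ : d - m.+1 = j.+1)%N 1?(_ : d - m.+2 = j)%N
  1?(_ : d - m = j.+2)%N; [|lia..].
by move: frec; rewrite -/g; lia.
Qed.

Theorem theorem6p5 (k : int) (n d : nat) (hn : (0 < n)%N) (hd : (0 < d)%N) :
  chi_exists n k (T2 d) <->
  exists alpha : int, (f k alpha d.+1 = 0 %[mod n%:Z])%Z.
Proof.
have dvdE alpha : (f k alpha d.+1 = 0 %[mod n%:Z])%Z <->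
    (n%:Z %| f k alpha d.+1)%Z.
  by rewrite -[f _ _ _ in X in _ <-> X]subr0 -eqz_mod_dvd; split=> /eqP.
split=> [/(f_dvd_of_chi_exists hd)[alpha]|[alpha]] /dvdE.
  by exists alpha.
exact: chi_exists_of_f_dvd.
Qed.
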